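(* Let $\mathrm{cl}$ be a closure operator on a finite set $V$ and let $A$ be a finite alphabet with $|A|\ge 2$. Then $\mathrm{cl}$ is solvable over $A$ if and only if $\mathrm{cl}$ is index-solvable over $A$.
   Context: Let $|V|=n$ and let $r=\min\{|b|: b\subseteq V,\ \mathrm{cl}(b)=V\}$ be the rank of $\mathrm{cl}$. For a family $f=(f_v)_{v\in V}$ of partitions of $A^r$, $f_X$ ($X\subseteq V$) denotes the common refinement of the $f_v$, $v\in X$ (parts are the nonempty intersections of parts; $f_\emptyset$ has one part). A coding function for $\mathrm{cl}$ over $A$ is a family $f=(f_v)_{v\in V}$ of partitions of $A^r$, each into at most $|A|$ parts, such that $f_X=f_{\mathrm{cl}(X)}$ for all $X\subseteq V$. $\mathrm{cl}$ is solvable over $A$ if it has a coding function $f$ such that $f_V$ is the partition of $A^r$ into singletons. The parts of each $f_v$ are labelled by $A$: $f_v=\{P_a(f_v):a\in A\}$, where some $P_a(f_v)$ may be empty. For $x\in A^n$ (coordinates indexed by $V$) put $P_x(f_V)=\bigcap_{v\in V}P_{x_v}(f_v)$ and $\mathrm{Im}(f)=\{x\in A^n: P_x(f_V)\neq\emptyset\}$. The solvability graph $\mathrm{G}(\mathrm{cl},A)$ is the undirected graph with vertex set $A^n$ in which $x,y$ are adjacent if and only if there is no coding function $f$ for $\mathrm{cl}$ over $A$ with $x,y\in\mathrm{Im}(f)$. $\mathrm{cl}$ is index-solvable over $A$ if $b(\mathrm{cl},A):=\log_{|A|}\chi(\mathrm{G}(\mathrm{cl},A))=n-r$, where $\chi$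 denotes the chromatic number. *)

(* Defs.v *)
From mathcomp Require Import all_boot all_order all_algebra.
From mathcomp Require Import reals exp.

Set Implicit Arguments.
Unset Strict Implicit.
Unset Printing Implicit Defensive.

Import GRing.Theory.

Section SimpleGraph.

Record sgraph := SGraph {
  svertex :> finType;
  sedge : rel svertex;
  sedge_sym : symmetric sedge;
  sedge_irr : irreflexive sedge }.

Variable G : sgraph.

Definition colorable (k : nat) : bool :=
  [exists c : {ffun G -> 'I_k},
     [forall x, forall y, sedge x y ==> (c x != c y)]].

Lemma ex_colorable : exists k, colorable k.
Proof.
exists #|G|; apply/existsP; exists [ffun x => enum_rank x].
apply/forallP => x; apply/forallP => y; apply/implyP => exy.
rewrite !ffunE; apply: contraTneq exy => /enum_rank_inj ->.
by rewrite sedge_irr.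
Qed.

Definition chromatic_number : nat := ex_minn ex_colorable.

End SimpleGraph.

Section Closure.

Variable V : finType.
Implicit Type cl : {set V} -> {set V}.

Definition closure_operator cl : Prop :=
  [/\ forall X : {set V}, X \subset cl X,
      forall X Y : {set V}, X \subset Y -> cl X \subset cl Y
    & forall X, cl (cl X) = cl X].

(* The default [set: V] is itself admissible when cl is a closure operator. *)
Definition rank cl : nat :=
  #|[arg min_(b < [set: V] | cl b == [set: V]) #|b| ]|.

Lemma rank_le cl : rank cl <= #|V|.
Proof. exact: max_card. Qed.

End Closure.

Section Partitions.

Variables (V A T : finType).
Implicit Type f : {ffun V -> {set {set T}}}.

(* Each g selects one part of f v for every v in X; its values outside X are
   irrelevant.  The intersection over the empty X is [set: T]. *)
Definition common_refinement f (X : {set V}) : {set {set T}} :=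
  [set \bigcap_(v in X) g v
     | g : {ffun V -> {set T}} & [forall v in X, g v \in f v]] :\ set0.

Definition coding_family (cl : {set V} -> {set V}) f : bool :=
  [forall v, partition (f v) [set: T] && (#|f v| <= #|A|)] &&
  [forall X, common_refinement f X == common_refinement f (cl X)].

(* P a is the part with label a.  Several labels may carry the empty set, but
   no nonempty part carries two labels. *)
Definition labelling (F : {set {set T}}) (P : {ffun A -> {set T}}) : bool :=
  (F == [set P a | a : A] :\ set0) &&
  [forall a, forall b, (a != b) ==> [disjoint P a & P b]].

Definition labelled_image (P : {ffun V -> {ffun A -> {set T}}}) :
    {set {ffun V -> A}} :=
  [set x : {ffun V -> A} | \bigcap_v P v (x v) != set0].

End Partitions.

Section Solvability.

Variables (V A : finType) (cl : {set V} -> {set V}).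

Local Notation word := {ffun 'I_(rank cl) -> A}.

Definition coding_function (f : {ffun V -> {set {set word}}}) : bool :=
  coding_family A cl f.

Definition solvable : Prop :=
  exists2 f : {ffun V -> {set {set word}}}, coding_function f &
    common_refinement f [set: V] = [set [set w] | w : word].

(* The labelling is part of the data of a coding function here, so it is
   quantified together with f. *)
Definition solv_edge : rel {ffun V -> A} := fun x y =>
  ~~ [exists f : {ffun V -> {set {set word}}},
      exists P : {ffun V -> {ffun A -> {set word}}},
      [&& coding_function f, [forall v, labelling (f v) (P v)],
          x \in labelled_image P & y \in labelled_image P]].

Lemma solv_edge_sym : symmetric solv_edge.
Proof.
move=> x y; congr (~~ _); apply: eq_existsb => f; apply: eq_existsb => P.
by rewrite [(x \in _) && _]andbC.
Qed.

Lemma solv_edge_irr : irreflexive solv_edge.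
Proof.
move=> x; apply/negbTE; rewrite negbK.
have [w _] : exists w : word, true.
  case: (posnP (rank cl)) => [r0|r_gt0].
    suff h : 'I_(rank cl) -> A by exists [ffun i => h i].
    by rewrite r0 => -[].
  have /card_gt0P [v _] := leq_trans r_gt0 (rank_le cl).
  by exists [ffun=> x v].
have T0 : [set: word] != set0 by apply/set0Pn; exists w.
have refE X : common_refinement [ffun=> [set [set: word]]] X
              = [set [set: word]] :> {set {set word}}.
  apply/setP => B; rewrite !inE; apply/andP/eqP => [[_]|->].
    case/imsetP => g; rewrite inE => /forall_inP gX ->.
    by apply: big1 => v /gX; rewrite ffunE inE => /eqP.
  split=> //; apply/imsetP; exists [ffun=> [set: word]].
    by rewrite inE; apply/forall_inP => v _; rewrite !ffunE inE.
  by rewrite big1 // => v _; rewrite ffunE.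
apply/existsP; exists [ffun=> [set [set: word]]].
apply/existsP; exists [ffun v => [ffun a => if a == x v then setT else set0]].
have xIm : x \in labelled_image
    [ffun v => [ffun a => if a == x v then [set: word] else set0]].
  by rewrite inE big1 // => v _; rewrite !ffunE eqxx.
rewrite !xIm !andbT; apply/andP; split.
  apply/andP; split; last by apply/forallP => X; rewrite !refE.
  apply/forallP => v; rewrite ffunE cards1; apply/andP; split.
    rewrite /partition /cover big_set1 eqxx trivIset1 /= inE.
    by rewrite eq_sym.
  by apply/card_gt0P; exists (x v).
apply/forallP => v; rewrite !ffunE; apply/andP; split.
  apply/eqP/setP => B; rewrite !inE; apply/eqP/andP => [->|[B0]].
    by split=> //; apply/imsetP; exists (x v) => //; rewrite ffunE eqxx.
  by case/imsetP => a _; rewrite ffunE; case: ifP => // _ BE; rewrite BE eqxx in B0.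
apply/forallP => a; apply/forallP => b; apply/implyP => ab.
rewrite !ffunE; case: (eqVneq a (x v)) => [ax|_].
  by rewrite -ax eq_sym (negbTE ab) -setI_eq0 setI0.
by rewrite -setI_eq0 set0I.
Qed.

Definition solvability_graph : sgraph := SGraph solv_edge_sym solv_edge_irr.

Local Open Scope ring_scope.

Definition index_of (R : realType) : R :=
  ln ((chromatic_number solvability_graph)%:R) / ln (#|A|%:R).

Definition index_solvable (R : realType) : Prop :=
  index_of R = #|V|%:R - (rank cl)%:R.

End Solvability.

(* Main.v *)
Require Import Defs.
From mathcomp Require Import all_boot all_order all_algebra.
From mathcomp Require Import reals exp.

(** Two words are non-adjacent in the solvability graph iff the set of
    coordinates where they agree is closed, so an independent set is a code
    whose pairwise agreement sets are closed.  Restriction to a basis is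
    injective on such a code, so it has at most q^r words (q = |A|), and cl is
    solvable iff q^r is attained.  Identifying A with Z_q, translations preserve
    agreement sets; the translates of an optimal code by the words supported
    outside the basis partition A^n into q^(n-r) independent sets.  Conversely a
    colouring with q^(n-r) colours has a class of at least q^r words. *)

Set Implicit Arguments.
Unset Strict Implicit.
Unset Printing Implicit Defensive.

Import Order.TTheory GRing.Theory Num.Theory.

(** A sigma type, because the injection is later used as data, one for each coordinate [v]. *)
Lemma inj_of_leq_card (S T : finType) :
  #|S| <= #|T| -> {h : S -> T | injective h}.
Proof.
move=> leST; exists (fun s => enum_val (widen_ord leST (enum_rank s))).
by move=> s s' /enum_val_inj /(congr1 val) /= /val_inj /enum_rank_inj.
Qed.

Lemma card_ffun_sig (V A : finType) (b : {set V}) :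
  #|{ffun {v | v \in b} -> A}| = #|A| ^ #|b|.
Proof. by rewrite card_ffun card_sig. Qed.

(** * Agreement sets of words *)

Section Agreement.

Variables (V A : finType).
Implicit Types x y z : {ffun V -> A}.

Definition agree x y : {set V} := [set v | x v == y v].

Lemma agreeC x y : agree x y = agree y x.
Proof. by apply/setP => v; rewrite !inE eq_sym. Qed.

Lemma agreexx x : agree x x = [set: V].
Proof. by apply/setP => v; rewrite !inE eqxx. Qed.

Lemma agreeT x y : [set: V] \subset agree x y -> x = y.
Proof.
by move=> /subsetP xy; apply/ffunP => v; have := xy v; rewrite !inE => /(_ isT)/eqP.
Qed.

(** For a closure operator the reverse inclusion is automatic, so this says that the agreement set
    is closed. *)
Definition closed_agreement (cl : {set V} -> {set V}) x y :=
  cl (agree x y) \subset agree x y.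

Lemma closed_agreement_refl cl x : closed_agreement cl x x.
Proof. by rewrite /closed_agreement agreexx subsetT. Qed.

Definition restr (b : {set V}) x : {ffun {v | v \in b} -> A} :=
  [ffun v => x (val v)].

Lemma restr_agree b x y : restr b x = restr b y -> b \subset agree x y.
Proof.
move=> /ffunP xy; apply/subsetP => v vb; rewrite inE.
by have := xy (Sub v vb); rewrite !ffunE /= => ->.
Qed.

End Agreement.

(** * Passing between coding families and codes *)

Section CodingFamilies.

Variables (V A T : finType) (cl : {set V} -> {set V}).

(** The shared parts over [X] intersect in a part of the refinement over [X]. This is also a part
    over [cl X], hence lies inside a single part of each [f v] with [v] in [cl X]. *)
Lemma coding_family_same_part (f : {ffun V -> {set {set T}}})
    (X : {set V}) t t' :
  coding_family A cl f ->
  (forall v, v \in X -> exists2 B, B \in f v & (t \in B) && (t' \in B)) ->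
  forall v, v \in cl X -> exists2 B, B \in f v & (t \in B) && (t' \in B).
Proof.
case/andP => _ /forallP /(_ X) /eqP fX tt' v vX.
have /fin_all_exists [g gP] : forall v, exists B : {set T},
    v \in X -> [&& B \in f v, t \in B & t' \in B].
  move=> u; case: (boolP (u \in X)) => [/tt' [B BB tB]|]; last by exists set0.
  by exists B => _; rewrite BB.
have tg : t \in \bigcap_(v in X) g v by apply/bigcapP => u /gP /and3P [].
have t'g : t' \in \bigcap_(v in X) g v by apply/bigcapP => u /gP /and3P [].
have: \bigcap_(v in X) g v \in common_refinement f X.
  rewrite !inE; apply/andP; split; first by apply/set0Pn; exists t.
  apply/imsetP; exists [ffun u => g u].
    by rewrite inE; apply/forall_inP => u /gP /and3P []; rewrite ffunE.
  by apply: eq_bigr => u _; rewrite ffunE.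
rewrite fX !inE => /andP [_ /imsetP [k]]; rewrite inE => /forall_inP kP gk.
exists (k v); first exact: kP.
by move: tg t'g; rewrite gk => /bigcapP -> // /bigcapP ->.
Qed.

Section FamilyOfCode.

Variable h : T -> {ffun V -> A}.

(** These are the fibres of the coordinate functions of [h]. Some may be empty; [code_family]
    discards those. *)
Definition code_labels : {ffun V -> {ffun A -> {set T}}} :=
  [ffun v => [ffun a => [set t | h t v == a]]].

Definition code_family : {ffun V -> {set {set T}}} :=
  [ffun v => [set code_labels v a | a : A] :\ set0].

Lemma in_code_labels v a t : (t \in code_labels v a) = (h t v == a).
Proof. by rewrite !ffunE inE. Qed.

Lemma labelling_code v : labelling (code_family v) (code_labels v).
Proof.
rewrite /labelling; apply/andP; split; first by rewrite [code_family v]ffunE.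
apply/forallP => a; apply/forallP => a'; apply/implyP => aa'.
apply/pred0P => t /=; rewrite !in_code_labels.
by apply/negbTE; apply: contra aa' => /andP [/eqP <- /eqP <-].
Qed.

Lemma labelled_image_code t : h t \in labelled_image code_labels.
Proof.
by rewrite inE; apply/set0Pn; exists t; apply/bigcapP => v _; rewrite in_code_labels.
Qed.

Lemma code_familyP v (B : {set T}) :
  reflect (exists2 t, t \in B & B = code_labels v (h t v)) (B \in code_family v).
Proof.
rewrite [code_family v]ffunE in_setD1; apply: (iffP andP).
  case=> /set0Pn [t tB] /imsetP [a _ BE]; exists t => //.
  by move: tB; rewrite BE in_code_labels => /eqP ->.
case=> t tB BE; split; first by apply/set0Pn; exists t.
by apply/imsetP; exists (h t v).
Qed.

Lemma partition_code v : partition (code_family v) [set: T].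
Proof.
apply/and3P; split.
- rewrite eqEsubset subsetT; apply/subsetP => t _; apply/bigcupP.
  have tL : t \in code_labels v (h t v) by rewrite in_code_labels.
  by exists (code_labels v (h t v)) => //; apply/code_familyP; exists t.
- apply/trivIsetP => B B' /code_familyP [t _ ->] /code_familyP [t' _ ->] BB'.
  apply/pred0P => s /=; rewrite !in_code_labels; apply/negbTE.
  by apply: contra BB' => /andP [/eqP -> /eqP ->].
- by rewrite [code_family v]ffunE !inE eqxx.
Qed.

(** Any point [t] of a nonempty intersection of fibres determines it: the fibre chosen at [v] must
    be the one over [h t v]. *)
Lemma common_refinement_code (X : {set V}) :
  common_refinement code_family X =
  [set [set s | X \subset agree (h s) (h t)] | t : T].
Proof.
have capE (g : {ffun V -> {set T}}) t :
    (forall v, v \in X -> g v = code_labels v (h t v)) ->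
    \bigcap_(v in X) g v = [set s | X \subset agree (h s) (h t)].
  move=> gE; apply/setP => s; rewrite inE; apply/bigcapP/subsetP => sP v vX.
    by have := sP v vX; rewrite gE // in_code_labels inE.
  by have := sP v vX; rewrite gE // in_code_labels inE.
apply/setP => B; rewrite !inE; apply/andP/imsetP.
  case=> /set0Pn [t tB] /imsetP [g]; rewrite inE => /forall_inP gP BE.
  exists t => //; rewrite BE; apply: capE => v vX.
  move: tB; rewrite BE => /bigcapP /(_ v vX).
  have /code_familyP [s _ ->] := gP v vX.
  by rewrite in_code_labels => /eqP ->.
case=> t _ ->; split.
  by apply/set0Pn; exists t; rewrite inE agreexx subsetT.
apply/imsetP; exists [ffun v => code_labels v (h t v)].
  rewrite inE; apply/forall_inP => v _; apply/code_familyP.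
  exists t; last by rewrite [LHS]ffunE.
  by rewrite [in X in _ \in X]ffunE in_code_labels.
by apply/esym/capE => v _; rewrite ffunE.
Qed.

(** A closed agreement set contains [X] exactly when it contains [cl X], so the refinements over
    both have the same parts. *)
Lemma coding_family_code : closure_operator cl ->
  (forall t t', closed_agreement cl (h t) (h t')) ->
  coding_family A cl code_family.
Proof.
case=> cl_ext cl_mono _ hcl; apply/andP; split; apply/forallP.
  move=> v; rewrite partition_code [code_family v]ffunE /=.
  by rewrite (leq_trans (subset_leq_card (subsetDl _ _))) ?leq_imset_card.
move=> X; rewrite !common_refinement_code; apply/eqP; apply: eq_imset => t.
apply/setP => s; rewrite !inE; apply/idP/idP => [/cl_mono Xs|].
  exact: subset_trans Xs (hcl _ _).
exact: subset_trans.
Qed.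

End FamilyOfCode.

(** Each [f v] has at most [#|A|] parts, so they can be named injectively by letters, and [h t]
    lists the names of the parts containing [t]. The second conclusion serves to derive injectivity
    of [h] when the full refinement consists of singletons. *)
Lemma code_of_coding_family (f : {ffun V -> {set {set T}}}) :
  coding_family A cl f ->
  exists h : T -> {ffun V -> A},
    (forall t t', closed_agreement cl (h t) (h t')) /\
    (forall v t t', h t v = h t' v ->
       exists2 B, B \in f v & (t \in B) && (t' \in B)).
Proof.
move=> fC; have /andP [/forallP fP _] := fC.
have part v : partition (f v) [set: T] by case/andP: (fP v).
have pin v t : pblock (f v) t \in f v.
  by rewrite pblock_mem // (cover_partition (part v)) inE.
have tin v t : t \in pblock (f v) t.
  by rewrite mem_pblock (cover_partition (part v)) inE.
have lab v : {l : {B | B \in f v} -> A | injective l}.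
  by apply: inj_of_leq_card; rewrite card_sig; case/andP: (fP v).
pose h t : {ffun V -> A} :=
  [ffun v => sval (lab v) (Sub (pblock (f v) t) (pin v t))].
have same v t t' : h t v = h t' v ->
    exists2 B, B \in f v & (t \in B) && (t' \in B).
  rewrite !ffunE => /(svalP (lab v)) /(congr1 val) /= pE.
  by exists (pblock (f v) t); rewrite ?pin // tin pE tin.
exists h; split=> // t t'; apply/subsetP => v vcl.
have [] := coding_family_same_part (t := t) (t' := t') fC _ vcl.
  by move=> u; rewrite inE => /eqP /same.
move=> B Bf /andP [tB t'B]; rewrite inE !ffunE.
have [_ /trivIsetP tI _] := and3P (part v).
have pE s : s \in B -> pblock (f v) s = B.
  move=> sB; apply: contraTeq sB => pB.
  by have := disjointFr (tI _ _ (pin v s) Bf pB) (tin v s) => ->.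
by apply/eqP; congr (sval _ _); apply: val_inj; rewrite /= !pE.
Qed.

End CodingFamilies.

(** * Edges and solvability in terms of codes *)

Section Solvability.

Variables (V A : finType) (cl : {set V} -> {set V}).
Hypotheses (hcl : closure_operator cl) (hA : 1 < #|A|).

Local Notation word := {ffun 'I_(rank cl) -> A}.
Local Notation chi := (chromatic_number (solvability_graph A cl)).

Lemma exists_basis : exists2 b : {set V}, cl b = [set: V] & #|b| = rank cl.
Proof.
rewrite /rank; case: arg_minnP => [|b /eqP bV _]; last by exists b.
(* The default value of the [arg min] has to be spanning itself. *)
by have [ext _ _] := hcl; rewrite eqEsubset subsetT ext.
Qed.

(** By monotonicity a closed agreement set containing a spanning set is all of [V]. Hence
    restriction to a basis is injective on codes. *)
Lemma closed_agreement_eq (b : {set V}) (x y : {ffun V -> A}) :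
  cl b = [set: V] -> closed_agreement cl x y -> b \subset agree x y -> x = y.
Proof.
have [_ mono _] := hcl => bV xy /mono; rewrite bV => /subset_trans /(_ xy).
exact: agreeT.
Qed.

Lemma card_word : #|word| = #|A| ^ rank cl.
Proof. by rewrite card_ffun card_ord. Qed.

(** If [x] and [y] label points [t] and [t'], agreement at [v] means that [t] and [t'] share a part
    of [f v], a property that passes to the closure. Conversely, [x] and [y] alone form a code,
    which yields a coding function. *)
Lemma solv_edgeE (x y : {ffun V -> A}) : solv_edge cl x y = ~~ closed_agreement cl x y.
Proof.
apply: negb_inj; rewrite !negbK; apply/idP/idP.
  case/existsP => f /existsP [P /and4P [fC /forallP Pl]].
  rewrite !inE => /set0Pn [t /bigcapP tP] /set0Pn [t' /bigcapP t'P].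
  apply/subsetP => v vcl.
  have [] := coding_family_same_part (t := t) (t' := t') fC _ vcl.
    move=> u; rewrite inE => /eqP xyu; exists (P u (x u)).
      have /andP [/eqP -> _] := Pl u; rewrite !inE imset_f // andbT.
      by apply/set0Pn; exists t; apply: tP.
    by rewrite tP // xyu t'P.
  move=> B; have /andP [/eqP -> /forallP dP] := Pl v.
  rewrite !inE => /andP [_ /imsetP [a _ ->]] /andP [ta t'a].
  (* Labels carry disjoint sets, so the common part has both labels [x v] and [y v]. *)
  have eqa c s : s \in P v c -> s \in P v a -> c = a.
    move=> sc sa; apply: contraTeq sa => ca.
    by have /forallP /(_ a) /implyP /(_ ca) /disjointFr -> := dP c.
  by rewrite (eqa _ _ (tP v isT) ta) (eqa _ _ (t'P v isT) t'a).
case: (eqVneq x y) => [->|xy] cxy; first exact: (negbFE (solv_edge_irr cl y)).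
have [b bV rb] := exists_basis.
(* The two-word code needs two points in [word]. In rank 0 there is only one, but then the empty set
   spans and forces [x = y]. *)
have r_gt0 : 0 < rank cl.
  rewrite -rb card_gt0; apply: contra xy => /eqP b0; apply/eqP.
  by apply: (closed_agreement_eq bV cxy); rewrite b0 sub0set.
have : 1 < #|word| by rewrite card_word -(exp1n (rank cl)) ltn_exp2r.
case/card_gt1P => t0 [t1 [_ _ t01]].
pose h (t : word) := if t == t0 then x else y.
apply/existsP; exists (code_family h); apply/existsP; exists (code_labels h).
apply/and4P; split.
- apply: coding_family_code => // t t'.
  rewrite /h; do 2!case: ifP => _ //; rewrite ?closed_agreement_refl //.
  by rewrite /closed_agreement agreeC.
- by apply/forallP => v; exact: labelling_code.
- by have := labelled_image_code h t0; rewrite {1}/h eqxx.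
- by have := labelled_image_code h t1; rewrite {1}/h eq_sym (negbTE t01).
Qed.

(** Singleton parts of the full refinement correspond to injectivity of [h]: points with the same
    codeword share a part at every coordinate. *)
Lemma solvableP : solvable A cl <->
  exists2 h : word -> {ffun V -> A}, injective h &
    forall t t', closed_agreement cl (h t) (h t').
Proof.
split=> [[f fC fV]|[h h_inj hC]].
  have [h [hC same]] := code_of_coding_family fC; exists h => // t t' /ffunP htt'.
  have /fin_all_exists2 [g gf gt] v := same v t t' (htt' v).
  have: \bigcap_v g v \in common_refinement f [set: V].
    rewrite !inE; apply/andP; split.
      by apply/set0Pn; exists t; apply/bigcapP => v _; case/andP: (gt v).
    apply/imsetP; exists [ffun v => g v].
      by rewrite inE; apply/forall_inP => v _; rewrite ffunE.
    by apply: eq_big => v; rewrite ?inE ?ffunE.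
  rewrite fV => /imsetP [w _ gw].
  have inw s : (forall v, s \in g v) -> s = w.
    by move=> sg; apply/set1P; rewrite -gw; apply/bigcapP => v _.
  by transitivity w; [|symmetry]; apply: inw => v; case/andP: (gt v).
exists (code_family h); first exact: coding_family_code.
rewrite common_refinement_code; apply: eq_imset => t; apply/setP => s.
rewrite !inE; apply/idP/eqP => [/agreeT/h_inj //|->].
by rewrite agreexx.
Qed.

(** * Colourings and codes *)

Lemma colorableP k :
  reflect (exists c : {ffun V -> A} -> 'I_k,
             forall x y, c x = c y -> closed_agreement cl x y)
          (colorable (solvability_graph A cl) k).
Proof.
apply: (iffP existsP) => [[c /forallP cP]|[c cP]].
  exists c => x y cxy; apply: contraTT (eqxx (c x)) => nxy.
  have /forallP /(_ y) /implyP := cP x; rewrite /= solv_edgeE -cxy.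
  exact.
exists [ffun x => c x]; apply/forallP => x; apply/forallP => y.
apply/implyP => /=; rewrite solv_edgeE !ffunE; apply: contra => /eqP.
exact: cP.
Qed.

(** A word is determined by its colour and its restriction to a basis, so the number of all words is
    at most [k * #|A| ^ rank cl]. *)
Lemma colorable_lower_bound k :
  colorable (solvability_graph A cl) k -> #|A| ^ (#|V| - rank cl) <= k.
Proof.
have [b bV rb] := exists_basis; case/colorableP => c cP.
have inj : injective (fun x => (c x, restr b x)).
  move=> x y [/cP cxy /restr_agree]; exact: closed_agreement_eq.
have := leq_card _ inj; rewrite card_prod card_ord card_ffun card_ffun_sig rb.
by rewrite -{1}(subnK (rank_le cl)) expnD leq_pmul2r // expn_gt0 (ltnW hA).
Qed.

(** The colour of [x] is its difference, off the basis, from the codeword that agrees with [x] on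
    the basis. Words of one colour are codewords translated by one vector. *)
Lemma colorable_of_code (h : word -> {ffun V -> A}) : injective h ->
  (forall t t', closed_agreement cl (h t) (h t')) ->
  colorable (solvability_graph A cl) (#|A| ^ (#|V| - rank cl)).
Proof.
move=> h_inj hC; have [b bV rb] := exists_basis.
(* Restriction to [b] is injective on the code and the cardinalities match, so it is bijective;
   [t_of] decodes through its inverse. *)
have [t_of t_ofP] : exists t_of : {ffun V -> A} -> word,
    forall x, b \subset agree (h (t_of x)) x.
  have restr_inj : injective (fun t => restr b (h t)).
    by move=> t t' /restr_agree /(closed_agreement_eq bV (hC t t')) /h_inj.
  have [|g _ gK] := inj_card_bij restr_inj.
    by rewrite card_ffun_sig card_word rb.
  by exists (fun x => g (restr b x)) => x; apply: restr_agree; rewrite gK.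
(* The successor form gives ['I_q.+1] its additive group structure. *)
have [q qE] : exists q, #|A| = q.+1 by exists #|A|.-1; rewrite prednK // ltnW.
have [e e_inj] : {e : A -> 'I_q.+1 | injective e}.
  by apply: inj_of_leq_card; rewrite card_ord qE.
pose c (x : {ffun V -> A}) : {ffun {v | v \in ~: b} -> 'I_q.+1} :=
  [ffun v => (e (x (val v)) - e (h (t_of x) (val v)))%R].
have cardc : #|{ffun {v | v \in ~: b} -> 'I_q.+1}| = #|A| ^ (#|V| - rank cl).
  by rewrite card_ffun_sig card_ord cardsCs setCK rb qE.
apply/colorableP; exists (fun x => cast_ord cardc (enum_rank (c x))) => x y.
move/cast_ord_inj/enum_rank_inj/ffunP => cxy.
suff -> : closed_agreement cl x y
    = closed_agreement cl (h (t_of x)) (h (t_of y)) by exact: hC.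
rewrite /closed_agreement; suff -> : agree x y = agree (h (t_of x)) (h (t_of y)) by [].
(* On [b] each word equals its codeword; off [b] the common difference cancels. *)
apply/setP => v; rewrite !inE; case: (boolP (v \in b)) => vb.
  have /subsetP /(_ v vb) := t_ofP x; have /subsetP /(_ v vb) := t_ofP y.
  by rewrite !inE => /eqP -> /eqP ->.
have vb' : v \in ~: b by rewrite inE.
have := cxy (Sub v vb'); rewrite !ffunE /= => E.
rewrite -(inj_eq e_inj) -[RHS](inj_eq e_inj).
apply/eqP/eqP => exy; last by move: E; rewrite exy => /addIr.
by move: E; rewrite exy => /addrI /oppr_inj.
Qed.

(** Pigeonhole: with this many colours the average class has [#|A| ^ rank cl] words, and a class at
    least that large contains an injective image of [word]. *)
Lemma code_of_colorable :
  colorable (solvability_graph A cl) (#|A| ^ (#|V| - rank cl)) ->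
  exists2 h : word -> {ffun V -> A}, injective h &
    forall t t', closed_agreement cl (h t) (h t').
Proof.
case/colorableP => c cP.
have [i Si] : exists i, #|word| <= #|[set x | c x == i]|.
  apply/existsP; apply: contraT; rewrite negb_exists => /forallP small.
  have k_gt0 : 0 < #|A| ^ (#|V| - rank cl) by rewrite expn_gt0 (ltnW hA).
  suff : #|{ffun V -> A}| < #|A| ^ (#|V| - rank cl) * #|word|.
    by rewrite card_word -expnD subnK ?rank_le // card_ffun ltnn.
  have w_gt0 : 0 < #|word| by rewrite card_word expn_gt0 (ltnW hA).
  (* Bounding each class by the predecessor allows a non-strict summation; strictness then comes
     from having at least one colour. *)
  apply: (@leq_ltn_trans (#|A| ^ (#|V| - rank cl) * #|word|.-1)); last first.
    by rewrite ltn_pmul2l // prednK.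
  rewrite -sum1_card (partition_big c xpredT) //= -[X in X * _]card_ord.
  rewrite -sum_nat_const; apply: leq_sum => j _.
  by rewrite sum1dep_card -ltnS prednK // ltnNge.
have [g g_inj] : {g : word -> {x | x \in [set x | c x == i]} | injective g}.
  by apply: inj_of_leq_card; rewrite card_sig.
exists (fun t => val (g t)) => [t t' /val_inj /g_inj //|t t']; apply: cP.
by have := valP (g t); have := valP (g t'); rewrite !inE => /eqP -> /eqP ->.
Qed.

(** * Chromatic number and index *)

Lemma solvable_chromatic :
  solvable A cl <-> chi = #|A| ^ (#|V| - rank cl).
Proof.
rewrite /chromatic_number; case: ex_minnP => k kcol kmin; split.
  case/solvableP => h h_inj hC; apply/anti_leq.
  by rewrite colorable_lower_bound // kmin // (colorable_of_code h_inj).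
by move=> kE; apply/solvableP/code_of_colorable; rewrite -kE.
Qed.

Lemma chromatic_number_gt0 : 0 < chi.
Proof.
rewrite /chromatic_number; case: ex_minnP => k /colorable_lower_bound + _.
by apply: leq_trans; rewrite expn_gt0 (ltnW hA).
Qed.

(** Since [#|A|] exceeds 1, its logarithm is nonzero and can be cleared; [ln] is injective on
    positive reals. As the rank is at most [#|V|], the truncated subtraction is the real one. *)
Lemma index_solvable_chromatic (R : realType) :
  index_solvable A cl R <-> chi = #|A| ^ (#|V| - rank cl).
Proof.
have q_gt1 : (1 < #|A|%:R :> R)%R by rewrite ltr1n.
have q_gt0 : (0 < #|A|%:R :> R)%R := lt_trans ltr01 q_gt1.
have lnq : (ln (#|A|%:R : R) != 0)%R by rewrite gt_eqF // ln_gt0.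
rewrite /index_solvable /index_of -natrB ?rank_le //.
split=> [E|->]; last by rewrite natrX lnXn // -[(ln _ *+ _)%R]mulr_natl mulfK.
have {}E : ln (chi%:R : R) = ln ((#|A| ^ (#|V| - rank cl))%:R : R).
  by rewrite natrX lnXn // -[(ln _ *+ _)%R]mulr_natl -E divfK.
apply/eqP; rewrite -(eqr_nat R); apply/eqP; apply: (ln_inj _ _ E).
  by rewrite posrE ltr0n chromatic_number_gt0.
by rewrite posrE natrX exprn_gt0.
Qed.

End Solvability.

Theorem theorem6 (R : realType) (V A : finType) (cl : {set V} -> {set V})
    (hcl : closure_operator cl) (hA : 1 < #|A|) :
  solvable A cl <-> index_solvable A cl R.
Proof.
exact: iff_trans (solvable_chromatic hcl hA)
  (iff_sym (index_solvable_chromatic hcl hA R)).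
Qed.
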